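(* Let $D$ be a domain with field of fractions $Q$, and let $A$ be a $D$-algebra which is torsion-free as a $D$-module. Then there is a maximal linearly independent subset $\{a_i\}$ of $A$ (in fact a basis of the $Q$-vector space $A_Q$) such that $A$ is contained as a $D$-module in a sandwich $$\bigoplus_i D a_i\subset A\subset A_Q,$$ and $\bigoplus_i Da_i$ is an essential $D$-submodule of $A$.
   Context: A domain is a commutative (unital) ring in which $xy=0$ implies $x=0$ or $y=0$. A $D$-algebra is a $D$-module with a $D$-bilinear product (not necessarily associative or unital). $A_Q=\{\frac{a}{d}: a\in A, d\in D\setminus\{0\}\}$ is the $Q$-vector space of fractions of $A$ (localization at $D\setminus\{0\}$); $A$ is identified with its image under the injective map $a\mapsto\frac a1$. A $D$-submodule $N'$ of $A$ is essential if it meets every nonzero $D$-submodule of $A$ nontrivially. *)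

(* Defs.v *)
From HB Require Import structures.
From mathcomp Require Import all_boot all_order all_algebra.
From mathcomp Require Import ring.
From mathcomp Require Import boolp classical_sets.

Set Implicit Arguments.
Unset Strict Implicit.
Unset Printing Implicit Defensive.

Import GRing.Theory.
Local Open Scope classical_set_scope.
Local Open Scope ring_scope.
Local Open Scope quotient_scope.

(** * Modules: sums of submodules, linear independence, essential submodules *)

Section Modules.
Variables (R : nzRingType) (V : lmodType R).
Implicit Types (S T N : set V) (u v : V).

Definition is_submodule N : Prop := submod_closed (mem N).

Definition torsion_free : Prop :=
  forall (r : R) v, r *: v = 0 -> r = 0 \/ v = 0.

Definition cyclic_submodule v : set V := [set r *: v | r in [set: R]].

(* Here and below, finite sums are indexed by a duplicate-free list, and only
   the values of the coefficient function on that list matter. *)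
Definition lin_span S : set V :=
  [set u | exists (s : seq V) (c : V -> R),
     [/\ uniq s, {in s, forall v, S v} & u = \sum_(v <- s) c v *: v]].

Definition lin_indep S : Prop :=
  forall (s : seq V) (c : V -> R), uniq s -> {in s, forall v, S v} ->
    \sum_(v <- s) c v *: v = 0 -> {in s, forall v, c v = 0}.

Definition max_lin_indep S : Prop :=
  lin_indep S /\ forall T, lin_indep T -> S `<=` T -> T = S.

Definition is_basis S : Prop := lin_indep S /\ lin_span S = setT.

Definition is_essential N : Prop :=
  is_submodule N /\
  forall N', is_submodule N' -> N' <> [set 0] -> N `&` N' <> [set 0].

End Modules.

Arguments torsion_free {R} V.

Section Sums.
Variables (V : zmodType) (I : choiceType).
Implicit Types (J : set I) (N : I -> set V).

Definition sum_of J N : set V :=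
  [set u | exists (s : seq I) (f : I -> V),
     [/\ uniq s, {in s, forall i, J i /\ N i (f i)} & u = \sum_(i <- s) f i]].

Definition sum_is_direct J N : Prop :=
  forall (s : seq I) (f : I -> V), uniq s ->
    {in s, forall i, J i /\ N i (f i)} ->
    \sum_(i <- s) f i = 0 -> {in s, forall i, f i = 0}.

End Sums.

(** * The module of fractions of a module over a domain *)

Notation "x %:F" := (@FracField.tofrac _ x) : ring_scope.
Notation nonzero D := {d : D | d != 0}.

Module FracModule.
Section FracModule.
Variables (D : idomainType) (A : lmodType D).

Definition nz1 : nonzero D := exist _ 1 (oner_neq0 D).

Definition nzmul (d e : nonzero D) : nonzero D :=
  exist _ (sval d * sval e) (mulf_neq0 (valP d) (valP e)).

Notation pre := (A * nonzero D)%type.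

Implicit Types x y z : pre.

(* The factor t makes this an equivalence relation for every module A; it can
   be dropped when A is torsion-free. *)
Definition equiv x y : bool :=
  `[< exists2 t : D, t != 0 &
        (t * sval y.2) *: x.1 = (t * sval x.2) *: y.1 >].

Lemma equivP x y :
  reflect (exists2 t : D, t != 0 &
             (t * sval y.2) *: x.1 = (t * sval x.2) *: y.1) (equiv x y).
Proof. exact: asboolP. Qed.

Lemma equiv_refl : reflexive equiv.
Proof. by move=> x; apply/equivP; exists 1; rewrite ?oner_neq0. Qed.

Lemma equiv_sym : symmetric equiv.
Proof.
by move=> x y; apply/equivP/equivP => -[t t0 h]; exists t.
Qed.

Lemma equiv_trans : transitive equiv.
Proof.
move=> [b e] [a d] [c f] /equivP[t t0 /= h] /equivP[s s0 /= k]; apply/equivP.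
exists (t * s * sval e) => /=; first by rewrite !mulf_neq0 // (valP e).
transitivity ((s * sval f) *: ((t * sval e) *: a)).
  by rewrite scalerA; congr (_ *: _); ring.
transitivity ((t * sval d) *: ((s * sval f) *: b)).
  by rewrite h !scalerA; congr (_ *: _); ring.
by rewrite k scalerA; congr (_ *: _); ring.
Qed.

Canonical equiv_equiv := EquivRel equiv equiv_refl equiv_sym equiv_trans.

Definition type := {eq_quot equiv}.

HB.instance Definition _ : EqQuotient _ equiv type := EqQuotient.on type.
HB.instance Definition _ := Choice.on type.

(* The fraction a / d. *)
Definition mk (a : A) (d : nonzero D) : type := \pi_type (a, d).

Lemma mk_eq a d b e :
  mk a d = mk b e <->
  exists2 t : D, t != 0 & (t * sval e) *: a = (t * sval d) *: b.
Proof.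
split; first by move=> /eqmodP /equivP.
by move=> h; apply/eqmodP/equivP.
Qed.

Lemma mkE a d b e : sval e *: a = sval d *: b -> mk a d = mk b e.
Proof. by move=> h; apply/mk_eq; exists 1; rewrite ?oner_neq0 ?mul1r. Qed.

Lemma mkK (u : type) : mk (repr u).1 (repr u).2 = u.
Proof. by rewrite /mk -surjective_pairing reprK. Qed.

Lemma mkW (P : type -> Prop) : (forall a d, P (mk a d)) -> forall u, P u.
Proof. by move=> h u; rewrite -(mkK u). Qed.

(* a / d + b / e = (e a + d b) / (d e) *)
Definition add (u v : type) : type :=
  let x := repr u in let y := repr v in
  mk (sval y.2 *: x.1 + sval x.2 *: y.1) (nzmul x.2 y.2).

Definition opp (u : type) : type := mk (- (repr u).1) (repr u).2.

Definition ratio_denom (r : {ratio D}) : nonzero D :=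
  exist _ \d_r (denom_ratioP r).

(* (n / m) (a / d) = (n a) / (m d) *)
Definition scale (q : {fraction D}) (u : type) : type :=
  let r := repr q in let x := repr u in
  mk (\n_r *: x.1) (nzmul (ratio_denom r) x.2).

Definition embed (a : A) : type := mk a nz1.

Lemma add_mk a d b e :
  add (mk a d) (mk b e) = mk (sval e *: a + sval d *: b) (nzmul d e).
Proof.
rewrite /add; case/mk_eq: (mkK (mk a d)) => t t0.
case/mk_eq: (mkK (mk b e)) => s s0.
case: (repr (mk a d)) => a' d'; case: (repr (mk b e)) => b' e' /= k h.
apply/mk_eq; exists (t * s); first exact: mulf_neq0.
rewrite /= !scalerDr !scalerA; congr (_ + _).
  transitivity ((s * sval e * sval e') *: ((t * sval d) *: a')).
    by rewrite scalerA; congr (_ *: _); ring.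
  by rewrite h scalerA; congr (_ *: _); ring.
transitivity ((t * sval d * sval d') *: ((s * sval e) *: b')).
  by rewrite scalerA; congr (_ *: _); ring.
by rewrite k scalerA; congr (_ *: _); ring.
Qed.

Lemma opp_mk a d : opp (mk a d) = mk (- a) d.
Proof.
rewrite /opp; case/mk_eq: (mkK (mk a d)) => t t0 h.
by apply/mk_eq; exists t; rewrite // !scalerN h.
Qed.

Lemma scale_mk (r : {ratio D}) a d :
  scale (\pi r) (mk a d) = mk (\n_r *: a) (nzmul (ratio_denom r) d).
Proof.
rewrite /scale; case/mk_eq: (mkK (mk a d)) => t t0.
have := FracField.equivf_l r; move: (repr (\pi r)) => r'.
case: (repr (mk a d)) => a' d' /= k h.
apply/mk_eq; exists t; rewrite //= !scalerA.
transitivity ((\n_r' * \d_r) *: ((t * sval d) *: a')).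
  by rewrite scalerA; congr (_ *: _); ring.
by rewrite h k scalerA; congr (_ *: _); ring.
Qed.

Lemma addA : associative add.
Proof.
elim/mkW=> a d; elim/mkW=> b e; elim/mkW=> c f; rewrite !add_mk /=.
apply: mkE; rewrite /= !scalerDr !scalerA addrA.
by congr (_ *: _ + _ *: _ + _ *: _); ring.
Qed.

Lemma addC : commutative add.
Proof.
elim/mkW=> a d; elim/mkW=> b e; rewrite !add_mk addrC.
by apply: mkE; congr (_ *: _); rewrite /= mulrC.
Qed.

Lemma add0 : left_id (embed 0) add.
Proof.
elim/mkW=> a d; rewrite add_mk; apply: mkE.
by rewrite /= scaler0 add0r scale1r mul1r.
Qed.

Lemma addN : left_inverse (embed 0) opp add.
Proof.
elim/mkW=> a d; rewrite opp_mk add_mk; apply: mkE.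
by rewrite scalerN addNr !scaler0.
Qed.

HB.instance Definition _ := GRing.isZmodule.Build type addA addC add0 addN.

Lemma scaleA p q u : scale p (scale q u) = scale (p * q) u.
Proof.
elim/quotW: p => r; elim/quotW: q => s; elim/mkW: u => a d.
rewrite -[_ * _]FracField.pi_mul !scale_mk; apply: mkE.
rewrite /= !numden_Ratio ?mulf_neq0 ?denom_ratioP // !scalerA.
by congr (_ *: _); ring.
Qed.

Lemma scale1 : left_id 1 scale.
Proof.
elim/mkW=> a d.
have -> : 1 = \pi_{fraction D} (Ratio 1 1).
  by rewrite -tofrac1; unlock FracField.tofrac.
rewrite scale_mk; apply: mkE.
by rewrite /= !numden_Ratio ?oner_neq0 // scale1r mul1r.
Qed.

Lemma scaleDr : right_distributive scale +%R.
Proof.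
elim/quotW=> r; elim/mkW=> a d; elim/mkW=> b e.
rewrite [mk a d + _]add_mk !scale_mk [RHS]add_mk; apply: mkE.
by rewrite /= !scalerDr !scalerA; congr (_ *: _ + _ *: _); ring.
Qed.

Lemma scaleDl u : {morph scale^~ u : p q / p + q}.
Proof.
elim/quotW=> r; elim/quotW=> s; elim/mkW: u => a d.
rewrite -[_ + _ in LHS]FracField.pi_add !scale_mk [RHS]add_mk; apply: mkE.
rewrite /= !numden_Ratio ?mulf_neq0 ?denom_ratioP //.
rewrite !scalerA -scalerDl !scalerA.
by congr (_ *: _); ring.
Qed.

HB.instance Definition _ :=
  GRing.Zmodule_isLmodule.Build {fraction D} type scaleA scale1 scaleDr scaleDl.

Lemma addE (u v : type) : u + v = add u v. Proof. by []. Qed.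

Lemma scaleE q (u : type) : q *: u = scale q u. Proof. by []. Qed.

Lemma embed_is_linear : linear_for (@FracField.tofrac D \; *:%R) embed.
Proof.
move=> c a b /=; unlock FracField.tofrac.
rewrite addE scaleE scale_mk add_mk; apply: mkE.
by rewrite /= !numden_Ratio ?oner_neq0 // !(mul1r, scale1r).
Qed.

HB.instance Definition _ :=
  GRing.isLinear.Build D A type _ embed embed_is_linear.

Lemma mkZ a (d : nonzero D) : mk a d = (sval d)%:F^-1 *: embed a.
Proof.
have d0 : (sval d)%:F != 0 by rewrite tofrac_eq0 (valP d).
apply: (scalerI d0); rewrite scalerA divff // scale1r.
unlock FracField.tofrac; rewrite scaleE scale_mk; apply: mkE.
by rewrite /= !numden_Ratio ?oner_neq0 // scale1r mul1r.
Qed.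

End FracModule.
End FracModule.
HB.export FracModule.

Notation fracmod := FracModule.type.
Notation tofracmod := (@FracModule.embed _ _).

(* Main.v *)
Require Import Defs.
From HB Require Import structures.
From mathcomp Require Import all_boot all_order all_algebra.
From mathcomp Require Import boolp classical_sets.

Import GRing.Theory.
Local Open Scope classical_set_scope.
Local Open Scope ring_scope.

(** Zorn's lemma gives a maximal linearly independent subset S of A
    ([max_lin_indep_exists]). Maximality says that adjoining any further v to S
    creates a linear relation, and independence of S forces the coefficient of
    v in that relation to be nonzero; hence every v has a nonzero multiple in
    the span of S ([max_lin_indep_multiple_in_span]). This fact gives both
    the spanning of A_Q and essentiality.

    - Over the field of fractions one can divide by the multiplier, so S spans
      A_Q ([tofracmod_lin_span]). Clearing denominators turns a relation over Q
      into a relation over D, so S stays independent in A_Q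
      ([tofracmod_lin_indep]).

    - The span of S is the internal direct sum of the cyclic modules D a, for a
      in S. A nonzero submodule contains some v <> 0; a nonzero multiple of v
      lies in the span, and it does not vanish because A is torsion-free. So
      the span meets that submodule nontrivially ([essential_of_multiples]).

    Torsion-freeness is also what makes A embed into A_Q
    ([tofracmod_inj]). *)

(** * Spans and maximal linearly independent sets *)

(** Two finite sums over different duplicate-free lists can be added once both
    are written over a common larger list. *)
Lemma sum_uniq_sub (V : nmodType) (I : eqType) (s r : seq I) (F : I -> V) :
  uniq s -> uniq r -> {subset s <= r} ->
  \sum_(i <- s) F i = \sum_(i <- r) (if i \in s then F i else 0).
Proof.
move=> us ur sr; rewrite -big_mkcond -big_filter; apply/perm_big/uniq_perm => //.
  exact: filter_uniq.
move=> i; rewrite mem_filter; case: (boolP (i \in s)) => // /sr -> //.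
Qed.

Section Modules.
Variables (R : nzRingType) (V : lmodType R).
Implicit Types (S N : set V) (u v : V).

Lemma lin_span_incl S v : S v -> lin_span S v.
Proof.
move=> Sv; exists [:: v], (fun=> 1); split=> //.
  by move=> w; rewrite inE => /eqP ->.
by rewrite big_seq1 scale1r.
Qed.

Lemma lin_span_submodule S : is_submodule (lin_span S).
Proof.
split=> [|a u v].
  by rewrite in_setE; exists [::], (fun=> 0); split=> //; rewrite big_nil.
rewrite !in_setE => -[s [c [us Ss ->]]] [t [e [ut St ->]]].
have ur : uniq (undup (s ++ t)) by exact: undup_uniq.
have sr : {subset s <= undup (s ++ t)}.
  by move=> w ws; rewrite mem_undup mem_cat ws.
have tr : {subset t <= undup (s ++ t)}.
  by move=> w wt; rewrite mem_undup mem_cat wt orbT.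
exists (undup (s ++ t)), (fun w =>
  a * (if w \in s then c w else 0) + (if w \in t then e w else 0)).
split=> //.
  by move=> w; rewrite mem_undup mem_cat => /orP[/Ss|/St].
rewrite (sum_uniq_sub _ _ s _ _ us ur sr) (sum_uniq_sub _ _ t _ _ ut ur tr).
rewrite scaler_sumr -big_split; apply: eq_bigr => w _ /=.
by rewrite scalerDl -scalerA; case: (w \in s); case: (w \in t); rewrite ?scale0r.
Qed.

Lemma submodN N u : is_submodule N -> N u -> N (- u).
Proof.
case=> N0 Nlin Nu; have := Nlin (-1) u 0; rewrite !in_setE addr0 scaleN1r.
by apply=> //; rewrite in_setE in N0.
Qed.

Lemma submodZ N a u : is_submodule N -> N u -> N (a *: u).
Proof.
case=> N0 Nlin Nu; have := Nlin a u 0; rewrite !in_setE addr0.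
by apply=> //; rewrite in_setE in N0.
Qed.

(** The coefficients have to be chosen: a member of a cyclic submodule R v
    determines its coefficient only when r v = 0 forces r = 0. *)
Lemma sum_of_cyclic S : sum_of S (@cyclic_submodule R V) = lin_span S.
Proof.
apply/seteqP; split=> u.
  move=> [s [f [us Sf ->]]].
  have /choice[c cP] : forall v, exists r : R, v \in s -> r *: v = f v.
    move=> v; have [/Sf[_ [r _ rv]]|] := boolP (v \in s); last by exists 0.
    by exists r.
  exists s, c; split=> //; first by move=> v /Sf[].
  by apply: eq_big_seq => v /cP ->.
move=> [s [c [us Ss ->]]]; exists s, (fun v => c v *: v); split=> //.
by move=> v vs; split; [exact: Ss | exists (c v)].
Qed.

Lemma lin_indep_direct S :
  lin_indep S -> sum_is_direct S (@cyclic_submodule R V).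
Proof.
move=> indS s f us Sf sum0.
have /choice[c cP] : forall v, exists r : R, v \in s -> r *: v = f v.
  move=> v; have [/Sf[_ [r _ rv]]|] := boolP (v \in s); last by exists 0.
  by exists r.
have c0 : {in s, forall v, c v = 0}.
  apply: indS => //; first by move=> v /Sf[].
  by rewrite -[RHS]sum0; apply: eq_big_seq => v /cP.
by move=> v vs; rewrite -cP // c0 // scale0r.
Qed.

(** In a relation over [v |` S], a nonzero coefficient c of v would put c v in
    the span of S; so that coefficient is 0, and what remains is a
    relation over S. *)
Lemma lin_indep_setU1 S v :
  lin_indep S -> (forall r, r != 0 -> ~ lin_span S (r *: v)) ->
  lin_indep (v |` S).
Proof.
move=> indS nspan s c us sS sum0.
have remS w : w \in rem v s -> S w.
  by rewrite mem_rem_uniq // => /andP[/eqP wv /sS []].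
have urem : uniq (rem v s) by exact: rem_uniq.
have [vs|vNs] := boolP (v \in s); last first.
  by apply: indS => // w ws; apply: remS; rewrite rem_id.
move: sum0; rewrite (big_rem v) //=.
have [cv0|cvn0] := eqVneq (c v) 0.
  rewrite cv0 scale0r add0r => /(indS _ _ urem remS) c0 w ws.
  have [->//|wv] := eqVneq w v.
  by apply: c0; rewrite mem_rem_uniq // inE wv.
move=> /eqP; rewrite addr_eq0 => /eqP cvE; case: (nspan _ cvn0).
rewrite cvE; apply: submodN; first exact: lin_span_submodule.
by exists (rem v s), c.
Qed.

(** If v had no nonzero multiple in the span, [v |` S] would still be independent, so
    v would be in S by maximality, and then 1 is a suitable multiplier. *)
Lemma max_lin_indep_multiple_in_span S v :
  max_lin_indep S -> exists2 r : R, r != 0 & lin_span S (r *: v).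
Proof.
move=> [indS maxS]; apply: contrapT => no_mult.
have indvS : lin_indep (v |` S).
  by apply: lin_indep_setU1 => // r r0 rv; apply: no_mult; exists r.
have vSE := maxS _ indvS (@subsetUr _ _ _).
apply: no_mult; exists 1; first exact: oner_neq0.
by rewrite scale1r; apply: lin_span_incl; rewrite -vSE; left.
Qed.

(** A relation involves only finitely many vectors, so in the union of a chain
    it already lives in a single member. The empty list is apart because the
    chain may be empty. *)
Lemma chain_seq_sub (T : eqType) (F : set (set T)) (s : seq T) :
  total_on F subset -> {in s, forall x, (\bigcup_(X in F) X) x} ->
  s = [::] \/ exists2 X, F X & {in s, forall x, X x}.
Proof.
move=> totF; elim: s => [|x s IHs] sF; first by left.
right; have [X FX Xx] := sF x (mem_head _ _).
case: IHs => [y ys|s0|[Y FY sY]].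
- by apply: sF; rewrite inE ys orbT.
- by exists X => // y; rewrite s0 inE => /eqP ->.
- have [XY|YX] := totF _ _ FX FY.
    by exists Y => // y; rewrite inE => /orP[/eqP->|/sY//]; apply: XY.
  by exists X => // y; rewrite inE => /orP[/eqP->//|/sY]; apply: YX.
Qed.

Lemma max_lin_indep_exists : exists S : set V, max_lin_indep S.
Proof.
have [|S [indS maxS]] := @Zorn_bigcup V (@lin_indep R V).
  move=> F Find totF s c us /(chain_seq_sub _ _ _ totF)[->//|[X FX sX]].
  exact: Find FX s c us sX.
exists S; split=> // T indT ST; apply: contrapT => TS.
by apply: (maxS T) => //; rewrite properEneq; split=> //; apply/eqP => /esym.
Qed.

End Modules.

(** * Clearing denominators and passing to fractions *)

Lemma frac_denom (D : idomainType) (q : {fraction D}) :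
  exists n d : D, d != 0 /\ d%:F * q = n%:F.
Proof.
elim/quotW: q => r; exists \n_r, \d_r; split; first exact: denom_ratioP.
unlock FracField.tofrac; rewrite -[LHS]FracField.pi_mul; apply/eqmodP.
rewrite /= FracField.equivfE /FracField.mulf.
rewrite !numden_Ratio ?(oner_neq0, mulf_neq0, denom_ratioP) //.
by rewrite !(mul1r, mulr1) mulrC.
Qed.

(** Coefficients that clear denominators on the tail are rescaled by the
    denominator of the head, and conversely. *)
Lemma common_denom (D : idomainType) (T : eqType) (s : seq T)
    (c : T -> {fraction D}) :
  exists (d : D) (n : T -> D),
    d != 0 /\ {in s, forall x, d%:F * c x = (n x)%:F}.
Proof.
elim: s => [|x s [d [n [d0 nP]]]].
  by exists 1, (fun=> 0); rewrite oner_neq0.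
have [m [e [e0 mP]]] := frac_denom _ (c x).
exists (e * d), (fun y => if y == x then d * m else e * n y); split.
  exact: mulf_neq0.
move=> y; rewrite inE; case: eqP => [-> _|_ /= ys].
  by rewrite !rmorphM /= -mP mulrCA mulrA.
by rewrite !rmorphM /= -mulrA nP.
Qed.

Section Fractions.
Variables (D : idomainType) (A : lmodType D).
Local Notation iota := (tofracmod : A -> fracmod A).

Lemma tofracmod_inj : torsion_free A -> injective iota.
Proof.
move=> tfA a b /FracModule.mk_eq[t t0].
rewrite /= mulr1 => /eqP; rewrite -subr_eq0 -scalerBr => /eqP /tfA[/eqP|/eqP].
  by rewrite (negPf t0).
by rewrite subr_eq0 => /eqP.
Qed.

Lemma tofracmodZ d a : iota (d *: a) = d%:F *: iota a.
Proof. by rewrite linearZ. Qed.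

Lemma tofracmod_sum (T : Type) (s : seq T) (n : T -> D) (f : T -> A) :
  iota (\sum_(i <- s) n i *: f i) = \sum_(i <- s) (n i)%:F *: iota (f i).
Proof. by rewrite linear_sum; apply: eq_bigr => i _; exact: tofracmodZ. Qed.

(** Lists of fractions that come from A are pulled back along this inverse. *)
Lemma tofracmod_linv : injective iota -> exists g, cancel iota g.
Proof.
move=> inj; exists (fun w => xget 0 [set a | iota a = w]) => a.
by apply: xget_unique => // b /inj.
Qed.

(** A relation over Q, multiplied by a common denominator d of its
    coefficients, comes from a relation over D in A, which is trivial; and d is
    not a zero divisor. *)
Lemma tofracmod_lin_indep (S : set A) :
  injective iota -> lin_indep S -> lin_indep (iota @` S : set (fracmod A)).
Proof.
move=> inj indS s c us sS sum0; have [g gK] := tofracmod_linv inj.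
have igK : {in s, forall w, iota (g w) = w}.
  by move=> w /sS[a _ <-]; rewrite gK.
have [d [n [d0 nP]]] := common_denom _ _ s c.
have n0 : {in map g s, forall a, n (iota a) = 0}.
  apply: indS.
  - rewrite map_inj_in_uniq // => w w' ws ws' gww'.
    by rewrite -(igK w) // -(igK w') // gww'.
  - by move=> _ /mapP[w ws ->]; have [a Sa <-] := sS _ ws; rewrite gK.
  apply: inj; rewrite big_map tofracmod_sum linear0.
  transitivity (d%:F *: \sum_(w <- s) c w *: w); last by rewrite sum0 scaler0.
  rewrite scaler_sumr; apply: eq_big_seq => w ws /=.
  by rewrite igK // scalerA nP.
move=> w ws; have := nP _ ws; rewrite -(igK w ws) n0; last exact: map_f.
rewrite igK // rmorph0 => /eqP; rewrite mulf_eq0 tofrac_eq0 (negPf d0) /=.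
by move/eqP.
Qed.

(** If r a is a combination of S over D, then a / d = d^-1 r^-1 (r a) is one
    over Q. *)
Lemma tofracmod_lin_span (S : set A) : injective iota ->
  (forall v, exists2 r : D, r != 0 & lin_span S (r *: v)) ->
  lin_span (iota @` S) = [set: fracmod A].
Proof.
move=> inj spanS; apply/seteqP; split=> // u _; elim/FracModule.mkW: u => a d.
have [g gK] := tofracmod_linv inj.
have [r r0 [s [c [us sS raE]]]] := spanS a.
rewrite FracModule.mkZ; apply: submodZ; first exact: lin_span_submodule.
have -> : iota a = r%:F^-1 *: iota (r *: a).
  by rewrite tofracmodZ scalerA mulVf ?tofrac_eq0 // scale1r.
apply: submodZ; first exact: lin_span_submodule.
exists (map iota s), (fun w => (c (g w))%:F); split.
- by rewrite map_inj_uniq.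
- by move=> _ /mapP[v vs ->]; exists v => //; apply: sS.
- rewrite raE tofracmod_sum big_map; apply: eq_bigr => v _.
  by rewrite gK.
Qed.

Lemma sum_of_cyclic_range (S : set A) :
  sum_of S (fun a => [set d%:F *: iota a | d in [set: D]]) `<=` range iota.
Proof.
move=> _ [s [f [_ Sf ->]]]; rewrite big_seq; elim/big_ind: _.
- by exists 0 => //; rewrite linear0.
- by move=> _ _ [a _ <-] [b _ <-]; exists (a + b) => //; rewrite linearD.
- by move=> a /Sf[_ [d _ <-]]; exists (d *: a) => //; rewrite tofracmodZ.
Qed.

End Fractions.

(** * Essential submodules *)

(** A nonzero v in the other submodule has a multiple r v in N with r <> 0, and
    r v <> 0 by torsion-freeness. *)
Lemma essential_of_multiples (D : idomainType) (A : lmodType D) (N : set A) :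
  torsion_free A -> is_submodule N ->
  (forall v, exists2 r : D, r != 0 & N (r *: v)) -> is_essential N.
Proof.
move=> tfA subN multN; split=> // N' subN' N'n0 NN'0; apply: N'n0.
apply/seteqP; split=> v; last first.
  by move=> ->; case: subN' => + _; rewrite in_setE.
move=> N'v; have [r r0 Nrv] := multN v.
have : (N `&` N') (r *: v) by split=> //; apply: submodZ.
by rewrite NN'0 => /tfA[/eqP|//]; rewrite (negPf r0).
Qed.

Theorem corollary1 (D : idomainType) (A : lmodType D)
    (mul : {bilinear A -> A -> A}) (tfA : torsion_free A) :
  exists S : set A,
    [/\ max_lin_indep S,
        is_basis (tofracmod @` S : set (fracmod A)),
        (* A is a D-submodule of A_Q *)
        injective (tofracmod : A -> fracmod A) /\
        linear_for (@FracField.tofrac D \; *:%R)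
          (tofracmod : A -> fracmod A),
        (* the sandwich, inside A_Q; the sum is direct *)
        sum_is_direct S (@cyclic_submodule D A) /\
        sum_of S (fun a => [set d%:F *: (tofracmod a : fracmod A)
                                | d in [set: D]])
          `<=` range (tofracmod : A -> fracmod A)
      & is_essential (sum_of S (@cyclic_submodule D A))].
Proof.
have [S maxS] := @max_lin_indep_exists D A; have [indS _] := maxS.
have inj := tofracmod_inj _ _ tfA.
have multS v := @max_lin_indep_multiple_in_span _ _ S v maxS.
exists S; split=> //.
- by split; [exact: tofracmod_lin_indep | exact: tofracmod_lin_span].
- by split=> //; exact: FracModule.embed_is_linear.
- by split; [exact: lin_indep_direct | exact: sum_of_cyclic_range].
- rewrite sum_of_cyclic; apply: essential_of_multiples => //.
  exact: lin_span_submodule.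
Qed.
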